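(* Let $K_c\subset\mathbb{E}^4$ be an unconditionally symmetric cap body of a ball. Then its illumination number satisfies $I(K_c)\le 8$. Moreover this bound is sharp: there exists an unconditionally symmetric cap body of a ball in $\mathbb{E}^4$ whose illumination number equals $8$.
   Context: Let $B^d$ be the closed unit ball of $\mathbb{E}^d$ centred at the origin. A cap body (of this ball) is $K_c=\operatorname{conv}\big(B^d\cup\{\boldsymbol v_i\mid i\in I\}\big)$ where $\{\boldsymbol v_i\mid i\in I\}$ is a countable subset of $\mathbb{E}^d\setminus B^d$ such that for any two distinct $i,j\in I$ the segment $\overline{\boldsymbol v_i\boldsymbol v_j}$ intersects $B^d$. It is unconditionally symmetric if it is symmetric with respect to each coordinate hyperplane $\{\boldsymbol x\mid x_i=0\}$, $i=1,\dots,d$ (with respect to the standard orthonormal basis). For a convex body $K$, a direction $\boldsymbol u\in\mathbb{S}^{d-1}$ illuminates a boundary point $\boldsymbol p$ of $K$ if $\boldsymbol p+\lambda\boldsymbol u$ lies in the interior of $K$ for some $\lambda>0$; the illumination number $I(K)$ is the smallest number of directions such that every boundary point of $K$ is illuminated by at least one of them. *)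

(* Defs.v *)
From HB Require Import structures.
From mathcomp Require Import all_boot all_order all_algebra.
From mathcomp Require Import reals.
Set Implicit Arguments. Unset Strict Implicit. Unset Printing Implicit Defensive.
Import Order.TTheory GRing.Theory Num.Theory.
Local Open Scope ring_scope.

Section Defs.
Variables (R : realType) (d : nat).
Notation pt := 'rV[R]_d.

Definition normsq (x : pt) : R := \sum_(i < d) x 0 i ^+ 2.

Definition unit_ball (x : pt) : Prop := normsq x <= 1.

Definition conv (S : pt -> Prop) (x : pt) : Prop :=
  exists s : seq (R * pt),
    (forall p, p \in s -> S p.2 /\ 0 <= p.1) /\
    \sum_(p <- s) p.1 = 1 /\
    x = \sum_(p <- s) p.1 *: p.2.

Definition interior (K : pt -> Prop) (x : pt) : Prop :=
  exists e : R, 0 < e /\ forall y : pt, normsq (y - x) < e -> K y.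
Definition closure (K : pt -> Prop) (x : pt) : Prop :=
  forall e : R, 0 < e -> exists y : pt, K y /\ normsq (y - x) < e.
Definition boundary (K : pt -> Prop) (x : pt) : Prop :=
  closure K x /\ ~ interior K x.

Definition illuminates (K : pt -> Prop) (u p : pt) : Prop :=
  exists lam : R, 0 < lam /\ interior K (p + lam *: u).

Definition illuminable (K : pt -> Prop) (n : nat) : Prop :=
  exists U : seq pt, (size U <= n)%N /\ (forall u, u \in U -> normsq u = 1) /\
    forall p, boundary K p -> exists2 u, u \in U & illuminates K u p.

Definition is_illumination_number (K : pt -> Prop) (n : nat) : Prop :=
  illuminable K n /\ forall m, illuminable K m -> (n <= m)%N.

Definition countable_set (V : pt -> Prop) : Prop :=
  exists f : nat -> pt, forall v, V v -> exists k, f k = v.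

Definition cap_vertices (V : pt -> Prop) : Prop :=
  countable_set V /\
  (forall v, V v -> ~ unit_ball v) /\
  (forall v w, V v -> V w -> v <> w ->
     exists t : R, 0 <= t <= 1 /\ unit_ball ((1 - t) *: v + t *: w)).

Definition cap_body (V : pt -> Prop) (x : pt) : Prop :=
  conv (fun y => unit_ball y \/ V y) x.

Definition reflect_coord (i : 'I_d) (x : pt) : pt :=
  \row_(j < d) (if j == i then - x 0 j else x 0 j).

Definition uncond_symmetric (K : pt -> Prop) : Prop :=
  forall (i : 'I_d) (x : pt), K x <-> K (reflect_coord i x).

End Defs.

(* Main.v *)
(* Upper bound. A vertex x, with s^2 = |x|^2 - 1, is illuminated by a unit
   vector u as soon as <u, x> < - s, and so is every point of a cap over x; unit
   vectors x satisfy the same criterion with s = 0.  Two distinct vertices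
   satisfy <v, w> <= 1 - s_v s_w, because the segment between them meets the
   ball.  The vertex set itself is unconditional, so the mirror image of v in a
   coordinate hyperplane gives |v|^2 - v_i^2 <= 1 whenever v_i <> 0.  Hence
   the directions +-e_i illuminate all vertices except the tight ones, whose
   nonzero coordinates all satisfy v_i^2 = |v|^2 - 1; up to order and signs
   these are (1,1,0,0), (1,1,1,0)/sqrt 2 and (1,1,1,1)/sqrt 3.  A tight vertex
   and its mirror images restrict all other vertices so much that some of the
   +-e_i can be replaced by directions (+-e_i +- e_j)/sqrt 2.

   Sharpness.  The vertices +-sqrt 2 e_i carry touching caps of angular radius
   pi/4, and illuminating the vertex +-sqrt 2 e_i requires u_i^2 > 1/2 with a
   prescribed sign, so that no unit vector serves two of them. *)
Require Import Defs.
From mathcomp Require Import all_boot all_order all_algebra.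
From mathcomp Require Import boolp reals ring lra.

Set Implicit Arguments.
Unset Strict Implicit.
Unset Printing Implicit Defensive.
Import Order.TTheory GRing.Theory Num.Theory.
Local Open Scope ring_scope.

(** * Inner product, squared norm and segments that meet the unit ball *)

Section Euclidean.
Variables (R : realType) (d : nat).
Implicit Types (x y p q v w u : 'rV[R]_d) (V : 'rV[R]_d -> Prop).

Definition dot x y : R := \sum_(i < d) x 0 i * y 0 i.

Lemma normsq_ge0 x : 0 <= normsq x.
Proof. by apply: sumr_ge0 => i _; rewrite sqr_ge0. Qed.

Lemma normsqD x y : normsq (x + y) = normsq x + 2 * dot x y + normsq y.
Proof.
rewrite /normsq /dot mulr_sumr -!big_split /=; apply: eq_bigr => i _.
rewrite mxE; ring.
Qed.

Lemma normsqZ a x : normsq (a *: x) = a ^+ 2 * normsq x.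
Proof.
by rewrite /normsq mulr_sumr; apply: eq_bigr => i _; rewrite mxE exprMn.
Qed.

Lemma normsqN x : normsq (- x) = normsq x.
Proof. by apply: eq_bigr => i _; rewrite mxE sqrrN. Qed.

Lemma dotC x y : dot x y = dot y x.
Proof. by apply: eq_bigr => i _; rewrite mulrC. Qed.

Lemma dotDr x y w : dot x (y + w) = dot x y + dot x w.
Proof. by rewrite /dot -big_split; apply: eq_bigr => i _; rewrite mxE mulrDr. Qed.

Lemma dotZr a x y : dot x (a *: y) = a * dot x y.
Proof. by rewrite /dot mulr_sumr; apply: eq_bigr => i _; rewrite mxE mulrCA. Qed.

Lemma dotDl x y w : dot (x + y) w = dot x w + dot y w.
Proof. by rewrite dotC dotDr !(dotC w). Qed.

Lemma dotZl a x y : dot (a *: x) y = a * dot x y.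
Proof. by rewrite dotC dotZr (dotC y). Qed.

Lemma dotxx x : dot x x = normsq x.
Proof. by []. Qed.

Lemma normsq_conv t x y : 0 <= t <= 1 ->
  normsq ((1 - t) *: x + t *: y) <= (1 - t) * normsq x + t * normsq y.
Proof.
move=> /andP[t0 t1]; rewrite /normsq !mulr_sumr -big_split /=.
apply: ler_sum => i _; rewrite !mxE.
rewrite -subr_ge0.
have -> : (1 - t) * x 0 i ^+ 2 + t * y 0 i ^+ 2
   - ((1 - t) * x 0 i + t * y 0 i) ^+ 2 =
  t * (1 - t) * (x 0 i - y 0 i) ^+ 2 by ring.
by apply: mulr_ge0; [apply: mulr_ge0; rewrite ?subr_ge0 | exact: sqr_ge0].
Qed.

(** Young's inequality with a free weight: in each coordinate the two sides differ by [c] times a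
    square. It controls perturbations of squared norms without square roots. *)
Lemma normsqD_le c x y : 0 < c ->
  normsq (x + y) <= (1 + c) * normsq x + (1 + c^-1) * normsq y.
Proof.
move=> c0; rewrite /normsq !mulr_sumr -big_split /=.
apply: ler_sum => i _; rewrite !mxE -subr_ge0.
have -> : (1 + c) * x 0 i ^+ 2 + (1 + c^-1) * y 0 i ^+ 2
   - (x 0 i + y 0 i) ^+ 2 = c * (x 0 i - c^-1 * y 0 i) ^+ 2.
  by field; rewrite gt_eqF.
by rewrite mulr_ge0 ?sqr_ge0 // ltW.
Qed.

Lemma ball_nbhs x : normsq x < 1 ->
  exists2 e : R, 0 < e & forall h, normsq h < e -> unit_ball (x + h).
Proof.
move=> x1; pose c := 1 - normsq x.
have c0 : 0 < c by rewrite subr_gt0.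
have c1 : c <= 1 by rewrite gerBl normsq_ge0.
have d0 : 0 < 1 + c^-1 by rewrite addr_gt0 ?invr_gt0.
(* With [normsq x = 1 - c] the bound becomes [(1 + c) * (1 - c) + c ^+ 2 = 1]. *)
exists (c ^+ 2 / (1 + c^-1)); first by rewrite divr_gt0 ?exprn_gt0.
move=> h; rewrite ltr_pdivlMr // => hh.
apply: le_trans (normsqD_le _ _ c0) _.
have -> : normsq x = 1 - c by rewrite /c; ring.
by rewrite mulrC in hh; nra.
Qed.

Lemma outside_nbhs p : 1 < normsq p ->
  exists e c : R, [/\ 0 < e, 0 < c &
    forall y, normsq (y - p) < e -> 1 + c <= normsq y].
Proof.
move=> p1; pose c := Num.min 1 (normsq p - 1) / 4.
have m0 : 0 < Num.min 1 (normsq p - 1) by rewrite lt_min ltr01 subr_gt0.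
have m1 : Num.min 1 (normsq p - 1) <= 1 by rewrite ge_min lexx.
have m2 : Num.min 1 (normsq p - 1) <= normsq p - 1 by rewrite ge_min lexx orbT.
have c0 : 0 < c by rewrite divr_gt0.
have c1 : c <= 1 by rewrite /c; lra.
have c2 : 1 + 4 * c <= normsq p by rewrite /c; lra.
have d0 : 0 < 1 + c^-1 by rewrite addr_gt0 ?invr_gt0.
(* If [normsq y < 1 + c], then [normsq p < (1 + c) ^+ 2 + c <= 1 + 4 * c]; hence the divisor 4 in
   [c]. *)
exists (c / (1 + c^-1)), c; split => //; first by rewrite divr_gt0.
move=> y; rewrite ltr_pdivlMr // mulrC => hh.
rewrite leNgt; apply/negP => yc.
have := normsqD_le y (p - y) c0.
rewrite addrC subrK -(normsqN (p - y)) opprB => hp.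
by nra.
Qed.

Definition meets x y := exists t : R, 0 <= t <= 1 /\ unit_ball ((1 - t) *: x + t *: y).

Lemma meets_sym x y : meets x y -> meets y x.
Proof.
move=> [t [/andP[t0 t1] h]]; exists (1 - t); split.
  by rewrite subr_ge0 t1 gerBl.
by rewrite subKr addrC.
Qed.

Lemma ball_conv a b x y : unit_ball x -> unit_ball y -> 0 <= a -> 0 <= b ->
  exists2 z, unit_ball z & a *: x + b *: y = (a + b) *: z.
Proof.
rewrite /unit_ball => hx hy a0 b0.
have [ab|ab] := eqVneq (a + b) 0.
  have -> : a = 0 by lra.
  have -> : b = 0 by lra.
  by exists x => //; rewrite !addr0 !scale0r addr0.
have ab0 : 0 < a + b by rewrite lt_def ab addr_ge0.
exists ((1 - b / (a + b)) *: x + (b / (a + b)) *: y).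
  have t0 : 0 <= b / (a + b) by rewrite divr_ge0 // ltW.
  have t1 : b / (a + b) <= 1 by rewrite ler_pdivrMr // mul1r lerDr.
  apply: le_trans (normsq_conv _ _ _) _; first by rewrite t0.
  by nra.
by apply/rowP => i; rewrite !mxE; field.
Qed.

(** In the triangle with corners [v], [w], [b], the segment from [w] to a point of the side between
    [v] and [b] crosses the segment joining [b] to the ball point on the side between [v] and [w].
    The crossing lies in the ball by convexity. *)
Lemma meets_slide t v w b : 0 <= t <= 1 -> unit_ball b -> ~ unit_ball w ->
  meets v w -> meets ((1 - t) *: v + t *: b) w.
Proof.
move=> /andP[t0 t1] hb hw [s [/andP[s0 s1] hs]].
have s1' : s < 1.
  rewrite lt_neqAle s1 andbT; apply/eqP => e; apply: hw.
  by move: hs; rewrite e subrr scale0r add0r scale1r.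
have st : 0 < 1 - s * t by nra.
have a0 : 0 <= 1 - t by lra.
have b0 : 0 <= (1 - s) * t by nra.
have [z hz e] := ball_conv hs hb a0 b0.
(* This is the share of [w] in the crossing point [z], which carries weight [1 - t] on the ball
   point and [(1 - s) * t] on [b], before division by [1 - s * t]. *)
exists ((1 - t) * s / (1 - s * t)); split.
  apply/andP; split; first by rewrite divr_ge0 ?mulr_ge0 // ltW.
  by rewrite ler_pdivrMr //; nra.
suff -> : (1 - (1 - t) * s / (1 - s * t)) *: ((1 - t) *: v + t *: b) +
    ((1 - t) * s / (1 - s * t)) *: w = z by [].
have st' : 1 - s * t != 0 by rewrite gt_eqF.
apply: (scalerI st').
have -> : (1 - s * t) *: z = (1 - t + (1 - s) * t) *: z by congr (_ *: _); ring.
rewrite -e; apply/rowP => i; rewrite !mxE.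
by field.
Qed.

End Euclidean.

(** * Local structure of cap bodies and a sufficient condition for illumination *)

Section CapBody.
Variables (R : realType) (d : nat).
Implicit Types (x y p q v w u : 'rV[R]_d) (V : 'rV[R]_d -> Prop).

(** The weights need not sum to 1, so that an induction on the list can maintain one ball point and
    at most one vertex. *)
Lemma cap_list V (s : seq (R * 'rV[R]_d)) : cap_vertices V ->
  (forall k, k \in s -> (unit_ball k.2 \/ V k.2) /\ 0 <= k.1) ->
  exists c b, [/\ 0 <= c, unit_ball b &
    (\sum_(k <- s) k.1 = c /\ \sum_(k <- s) k.1 *: k.2 = c *: b) \/
    exists e w, [/\ V w, 0 <= e, \sum_(k <- s) k.1 = c + e &
      \sum_(k <- s) k.1 *: k.2 = c *: b + e *: w]].
Proof.
move=> [_ [Vout Vmeet]]; elim: s => [_|[a x] s IH hs].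
  exists 0, 0; split => //.
    by rewrite /unit_ball /normsq big1 // => i _; rewrite mxE expr0n.
  by left; rewrite !big_nil scale0r.
have [|c [b [c0 hb hcb]]] := IH; first by move=> p hp; apply: hs; rewrite inE hp orbT.
have [hx /= a0] := hs (a, x) (mem_head _ _).
rewrite !big_cons /=.
case: hx => /= hx.
  have [z hz e] := ball_conv hx hb a0 c0.
  exists (a + c), z; split => //; first exact: addr_ge0.
  case: hcb => [[-> ->]|[f [w [hw f0 -> ->]]]]; first by left.
  by right; exists f, w; rewrite !addrA e.
case: hcb => [[-> ->]|[f [w [hw f0 -> ->]]]].
  by exists c, b; split => //; right; exists a, x; split; rewrite // addrC.
have [<-|xw] := eqVneq x w.
  exists c, b; split => //; right; exists (a + f), x; split => //.
  - exact: addr_ge0.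
  - by rewrite addrCA.
  - by rewrite scalerDl addrCA.
have [t [/andP[t0 t1] hq]] := Vmeet _ _ hx hw (elimN eqP xw).
(* A multiple of the ball point between [x] and [w] is split off until one of the two vertices is
   used up: [x] in the first case, [w] in the second. *)
have [h|h] := lerP (a * t) (f * (1 - t)).
- have t1' : 0 < 1 - t.
    rewrite subr_gt0 lt_neqAle t1 andbT; apply/eqP => e; apply: (Vout _ hw).
    by move: hq; rewrite e subrr scale0r add0r scale1r.
  have m0 : 0 <= a / (1 - t) by rewrite divr_ge0 // ltW.
  have [z hz e] := ball_conv hq hb m0 c0.
  exists (a / (1 - t) + c), z; split => //; first exact: addr_ge0.
  right; exists (f - a / (1 - t) * t), w; split => //.
  + by rewrite subr_ge0 mulrAC ler_pdivrMr.
  + by field; rewrite gt_eqF.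
  + by rewrite -e; apply/rowP => i; rewrite !mxE; field; rewrite gt_eqF.
- have t0' : 0 < t.
    rewrite lt_neqAle t0 andbT; apply/eqP => e; move: h.
    by rewrite -e mulr0 subr0 mulr1 ltNge f0.
  have m0 : 0 <= f / t by rewrite divr_ge0 // ltW.
  have [z hz e] := ball_conv hq hb m0 c0.
  exists (f / t + c), z; split => //; first exact: addr_ge0.
  right; exists (a - f / t * (1 - t)), x; split => //.
  + by rewrite subr_ge0 mulrAC ler_pdivrMr // ltW.
  + by field; rewrite gt_eqF.
  + by rewrite -e; apply/rowP => i; rewrite !mxE; field; rewrite gt_eqF.
Qed.

(* Since every segment between two vertices meets the ball, two vertices can
   always be traded for one vertex and a point of the ball. *)
Lemma cap_bodyP V x : cap_vertices V -> cap_body V x ->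
  unit_ball x \/
  exists v t b, [/\ V v, 0 <= t <= 1, unit_ball b & x = (1 - t) *: v + t *: b].
Proof.
move=> hV [s [hs [s1 ->]]].
have [c [b [c0 hb]]] := cap_list hV hs.
rewrite s1 => -[[<- ->]|[e [w [hw e0 ce ->]]]]; first by left; rewrite scale1r.
right; exists w, c, b; split => //; first by rewrite c0 ce lerDl.
by rewrite ce addrAC subrr add0r addrC.
Qed.

Lemma ball_cap_body V x : unit_ball x -> cap_body V x.
Proof.
move=> hx; exists [:: (1, x)]; split; last by rewrite !big_seq1 scale1r.
by move=> p; rewrite inE => /eqP -> /=; split => //; left.
Qed.

Lemma vertex_cap_body V v : V v -> cap_body V v.
Proof.
move=> hx; exists [:: (1, v)]; split; last by rewrite !big_seq1 scale1r.
by move=> p; rewrite inE => /eqP -> /=; split => //; right.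
Qed.

Lemma cap_body3 V a b c v x y : V v -> unit_ball x -> unit_ball y ->
  0 <= a -> 0 <= b -> 0 <= c -> a + b + c = 1 ->
  cap_body V (a *: v + b *: x + c *: y).
Proof.
move=> hv hx hy a0 b0 c0 abc; exists [:: (a, v); (b, x); (c, y)].
rewrite !big_cons !big_nil /= !addr0 !addrA; split => //.
move=> p; rewrite !inE => /or3P[] /eqP -> /=; split => //; by [left|right].
Qed.

(** Close to [p] all points stay outside the ball. If two of them lay in caps over different
    vertices, sliding both vertices to these points would give a segment that meets the ball, yet
    stays close to [p]. *)
Lemma cap_body_local V p : cap_vertices V -> 1 < normsq p ->
  Defs.closure (cap_body V) p ->
  exists v e c, [/\ V v, 0 < e, 0 < c & forall y, cap_body V y -> normsq (y - p) < e ->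
    1 + c <= normsq y /\
    exists t b, [/\ 0 <= t <= 1, unit_ball b & y = (1 - t) *: v + t *: b]].
Proof.
move=> hV p1 hp; have [e [c [e0 c0 hec]]] := outside_nbhs p1.
have out y : normsq (y - p) < e -> ~ unit_ball y.
  move=> /hec h1 h2; have := le_trans h1 h2.
  by rewrite gerDl leNgt c0.
have cone y : cap_body V y -> normsq (y - p) < e ->
    exists v t b, [/\ V v, 0 <= t <= 1, unit_ball b & y = (1 - t) *: v + t *: b].
  by move=> /(cap_bodyP hV) [hy /out|].
have [y0 [hy0 y0p]] := hp e e0.
have [v [t0 [b0 [hv ht0 hb0 y0E]]]] := cone _ hy0 y0p.
exists v, e, c; split => // y hy yp; split; first exact: hec.
have [w [t [b [hw ht hb yE]]]] := cone _ hy yp.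
have [vw|vw] := eqVneq v w; first by exists t, b; rewrite vw.
exfalso; case: hV => _ [Vout Vmeet].
have m1 := Vmeet _ _ hv hw (elimN eqP vw).
have m2 := meets_slide ht0 hb0 (Vout _ hw) m1.
rewrite -y0E in m2.
have m3 := meets_slide ht hb (out _ y0p) (meets_sym m2).
rewrite -yE in m3.
have [r [hr hz]] := m3; apply: out hz.
have -> : (1 - r) *: y + r *: y0 - p = (1 - r) *: (y - p) + r *: (y0 - p).
  by apply/rowP => i; rewrite !mxE; ring.
apply: le_lt_trans (normsq_conv _ _ hr) _.
apply: le_lt_trans (_ : _ <= Num.max (normsq (y - p)) (normsq (y0 - p))) _; last first.
  by rewrite gt_max yp.
case/andP: hr => r0 r1; set M := Num.max _ _.
have h1 : normsq (y - p) <= M by rewrite le_max lexx.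
have h2 : normsq (y0 - p) <= M by rewrite le_max lexx orbT.
by nra.
Qed.

Lemma interior_ball V x : normsq x < 1 -> interior (cap_body V) x.
Proof.
move=> /ball_nbhs[e e0 h]; exists e; split=> // y /h.
by rewrite addrC subrK; exact: ball_cap_body.
Qed.

(* For a unit vector [u] and [1 <= normsq x] this says that [x + lam *: u] with [lam = - dot u x]
   lies in the open unit ball. *)
Definition aims u x := dot u x < 0 /\ normsq x - 1 < dot u x ^+ 2.

Lemma aims_ball u x : normsq u = 1 -> aims u x -> normsq (x + (- dot u x) *: u) < 1.
Proof. by move=> u1 [h1 h2]; rewrite normsqD normsqZ dotZr u1 (dotC x); nra. Qed.

(** A point of the cap near [p] gives [v] a weight bounded below, and moving a share [s] of that
    weight by [lam *: u] carries it into the open ball. As [p] is only known to lie in the closure,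
    the argument runs through a nearby point [y] of the body. *)
Lemma illuminates_cap V p v u e c : cap_vertices V -> Defs.closure (cap_body V) p ->
  normsq u = 1 -> aims u v -> V v -> 0 < e -> 0 < c ->
  (forall y, cap_body V y -> normsq (y - p) < e ->
    1 + c <= normsq y /\
    exists t b, [/\ 0 <= t <= 1, unit_ball b & y = (1 - t) *: v + t *: b]) ->
  illuminates (cap_body V) u p.
Proof.
move=> hV hp u1 huv hv e0 c0 hloc.
have [lt0 _] := huv.
have [r r0 hr] := ball_nbhs (aims_ball u1 huv).
set lam := - dot u v in hr; have lam0 : 0 < lam by rewrite oppr_gt0.
have v1 : 0 < normsq v - 1.
  by rewrite subr_gt0 ltNge; apply/negP; exact: (hV.2.1 _ hv).
(* From [1 + c <= normsq y <= (1 - t) * normsq v + t] the weight [1 - t] of [v] is at least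
   [c / (normsq v - 1)]. *)
pose s := Num.min 1 (c / (normsq v - 1)).
have s0 : 0 < s by rewrite lt_min ltr01 divr_gt0.
have s1 : s <= 1 by rewrite ge_min lexx.
have sc : s * (normsq v - 1) <= c.
  by rewrite -ler_pdivlMr // ge_min lexx orbT.
exists (s * lam); split; first exact: mulr_gt0.
(* The factor 4 absorbs two errors below [f], each doubled by [normsqD_le] with weight 1. *)
pose f := s ^+ 2 * r / 4.
have f0 : 0 < f by rewrite /f !mulr_gt0 ?exprn_gt0 ?invr_gt0.
exists f; split => // q hq.
have ef0 : 0 < Num.min e f by rewrite lt_min e0.
have [y [hy]] := hp _ ef0; rewrite lt_min => /andP[ye yf].
have [yc [t [b [/andP[t0 t1] hb yE]]]] := hloc y hy ye.
have ts : s <= 1 - t.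
  have t01 : 0 <= t <= 1 by rewrite t0.
  have := normsq_conv v b t01; rewrite -yE => ny.
  rewrite /unit_ball in hb; rewrite -(ler_pM2r v1); nra.
pose h := s^-1 *: ((q - (p + (s * lam) *: u)) + (p - y)).
have hh : normsq h < r.
  rewrite normsqZ exprVn mulrC ltr_pdivrMr ?exprn_gt0 //.
  apply: le_lt_trans (normsqD_le _ _ ltr01) _.
  rewrite -(normsqN (p - y)) opprB invr1.
  by rewrite /f in hq yf; lra.
have -> : q = (1 - t - s) *: v + t *: b + s *: (v + lam *: u + h).
  have s0' : s != 0 by rewrite gt_eqF.
  rewrite /h yE; apply/rowP => i; rewrite !mxE.
  by field.
apply: cap_body3 => //; first exact: hr.
- by rewrite subr_ge0.
- exact: ltW.
- ring.
Qed.

(** A boundary point outside the ball inherits a direction from the vertex of its cap; one on the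
    sphere is moved directly into the open ball. *)
Lemma illuminable_aims V (U : seq 'rV[R]_d) : cap_vertices V ->
  (forall u, u \in U -> normsq u = 1) ->
  (forall x, V x \/ normsq x = 1 -> exists2 u, u \in U & aims u x) ->
  illuminable (cap_body V) (size U).
Proof.
move=> hV U1 hU; exists U; split => //; split => // p [hcl hint].
have [p1|p1|p1] := ltgtP (normsq p) 1.
- by case: hint; exact: interior_ball.
- have [v [e [c [hv e0 c0 hloc]]]] := cap_body_local hV p1 hcl.
  have [u uU hu] := hU v (or_introl hv).
  exists u => //; apply: illuminates_cap hloc => //; exact: U1.
- have [u uU hu] := hU p (or_intror p1).
  exists u => //; exists (- dot u p); split; first by rewrite oppr_gt0 hu.1.
  by apply: interior_ball; apply: aims_ball => //; exact: U1.
Qed.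

End CapBody.

(** * Symmetry of the vertex set and the distance constraints between vertices *)

Section Symmetry.
Variables (R : realType) (d : nat).
Implicit Types (x y p q v w u : 'rV[R]_d) (V : 'rV[R]_d -> Prop) (i j : 'I_d).

Lemma reflect_coordK i : involutive (@reflect_coord R d i).
Proof. by move=> x; apply/rowP => j; rewrite !mxE; case: eqP; rewrite ?opprK. Qed.

Lemma reflect_coord_lin i a b x y :
  reflect_coord i (a *: x + b *: y) = a *: reflect_coord i x + b *: reflect_coord i y.
Proof. by apply/rowP => j; rewrite !mxE; case: eqP => _ //; ring. Qed.

Lemma normsq_abs x y : (forall i, `|x 0 i| = `|y 0 i|) -> normsq x = normsq y.
Proof. by move=> h; apply: eq_bigr => i _; rewrite -real_normK ?num_real // h real_normK ?num_real. Qed.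

Lemma normsq_reflect i x : normsq (reflect_coord i x) = normsq x.
Proof. by apply: normsq_abs => j; rewrite mxE; case: eqP; rewrite ?normrN. Qed.

Lemma cap_cone V i v : cap_vertices V -> V v -> cap_body V (reflect_coord i v) ->
  exists w t b, [/\ V w, 0 <= t <= 1, unit_ball b &
    reflect_coord i v = (1 - t) *: w + t *: b].
Proof.
move=> hV hv /(cap_bodyP hV)[h|//]; exfalso; apply: (hV.2.1 _ hv).
by move: h; rewrite /unit_ball normsq_reflect.
Qed.

(** The reflected vertex lies in a cap over some [w], and reflecting [w] in turn puts [v] into a cap
    over some [w']. A vertex lies in no cap but its own, so [w' = v]; as [v] is outside the ball,
    the ball points then get weight 0. *)
Lemma vertex_reflect V i v : cap_vertices V -> uncond_symmetric (cap_body V) ->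
  V v -> V (reflect_coord i v).
Proof.
move=> hV hS hv; have [_ [Vout Vmeet]] := hV.
have h1 : cap_body V (reflect_coord i v).
  by rewrite -hS; exact: vertex_cap_body.
have [w [t [b [hw ht hb vE]]]] := cap_cone hV hv h1.
have h2 : cap_body V (reflect_coord i w) by rewrite -hS; exact: vertex_cap_body.
have [w' [t' [b' [hw' ht' hb' wE]]]] := cap_cone hV hw h2.
have vE' : v = (1 - t) *: ((1 - t') *: w' + t' *: b') + t *: reflect_coord i b.
  by rewrite -wE -reflect_coord_lin -vE reflect_coordK.
have hrb : unit_ball (reflect_coord i b) by rewrite /unit_ball normsq_reflect.
have vw' : v = w'.
  have [//|/eqP vw'] := eqVneq v w'; exfalso; apply: (Vout _ hv).
  have m1 := meets_slide ht' hb' (Vout _ hv) (meets_sym (Vmeet _ _ hv hw' vw')).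
  have m2 := meets_slide ht hrb (Vout _ hv) m1.
  (* The segment has shrunk to the single point [v]. *)
  rewrite -vE' in m2; case: m2 => r [_].
  by rewrite -scalerDl subrK scale1r.
case/andP: ht => t0 t1; case/andP: ht' => t0' t1'.
have a0 : 0 <= (1 - t) * t' by rewrite mulr_ge0 // subr_ge0.
have [z hz e] := ball_conv hb' hrb a0 t0.
have vz : ((1 - t) * t' + t) *: v = ((1 - t) * t' + t) *: z.
  rewrite -e; move/rowP: vE' => vE'; apply/rowP => j; have := vE' j.
  rewrite -vw' !mxE => h.
  transitivity (v 0 j - (1 - t) * (1 - t') * v 0 j); first by ring.
  by rewrite [in X in X - _]h; ring.
have [k0|k0] := eqVneq ((1 - t) * t' + t) 0; last first.
  by case: (Vout _ hv); rewrite (scalerI k0 vz).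
have -> : reflect_coord i v = w; last by [].
have t00 : t = 0 by lra.
by rewrite vE t00 subr0 scale1r scale0r addr0.
Qed.

Lemma vertex_abs V x y : cap_vertices V -> uncond_symmetric (cap_body V) ->
  V x -> (forall i, `|x 0 i| = `|y 0 i|) -> V y.
Proof.
move=> hV hS hx hxy.
suff H (s : seq 'I_d) : forall z, V z ->
    (forall i, y 0 i = z 0 i \/ (i \in s) /\ y 0 i = - z 0 i) -> V y.
  apply: (H (enum 'I_d) x hx) => i; rewrite mem_enum.
  have /eqP := hxy i; rewrite eqr_norm2 => /orP[] /eqP ->; first by left.
  by right; rewrite opprK.
elim: s => [|i s IH] z hz h.
  suff <- : z = y by [].
  by apply/rowP => i; case: (h i) => [|[]].
have [e|e] := eqVneq (y 0 i) (z 0 i).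
  apply: (IH z hz) => j; case: (h j) => [|[js e']]; first by left.
  move: js; rewrite inE => /orP[/eqP ji|js]; last by right.
  by left; rewrite ji.
apply: (IH _ (vertex_reflect i hV hS hz)) => j; rewrite mxE.
case: eqP => [->|/eqP ji]; first by left; case: (h i) e => [->|[]//]; rewrite eqxx.
case: (h j) => [|[]]; first by left.
by rewrite inE (negPf ji) => /= js e'; right.
Qed.

(* With [normsq x = 1 + s ^+ 2], the number [s] is the length of the tangent
   segments from [x] to the ball. *)
Lemma vertex_dot V v w (r s : R) : cap_vertices V -> V v -> V w -> v <> w ->
  0 <= r -> 0 <= s -> normsq v = 1 + r ^+ 2 -> normsq w = 1 + s ^+ 2 ->
  dot v w <= 1 - r * s.
Proof.
move=> [_ [Vout Vmeet]] hv hw vw r0 s0 nv nw.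
have r0' : 0 < r ^+ 2 by have /negP := Vout _ hv; rewrite /unit_ball -ltNge nv ltrDl.
have s0' : 0 < s ^+ 2 by have /negP := Vout _ hw; rewrite /unit_ball -ltNge nw ltrDl.
have [t [/andP[t0 t1]]] := Vmeet _ _ hv hw vw; clear vw.
rewrite /unit_ball normsqD !normsqZ dotZl dotZr nv nw => h.
rewrite leNgt; apply/negP => hlt.
have t0' : 0 < t.
  rewrite lt_neqAle t0 andbT; apply/eqP => e; move: h; rewrite -e subr0 => h; nra.
have t1' : 0 < 1 - t.
  rewrite lt_neqAle subr_ge0 t1 andbT; apply/eqP => e; move: h; rewrite -e.
  have -> : t = 1 by lra.
  by nra.
have tt : 0 < t * (1 - t) by exact: mulr_gt0.
(* The squared norm at parameter [t] equals [1 + ((1 - t) * r - t * s) ^+ 2 + 2 * t * (1 - t) * (dot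
   v w - (1 - r * s))]. *)
have h3 : 0 < t * (1 - t) * (dot v w - (1 - r * s)) by rewrite mulr_gt0 // subr_gt0.
have h4 : 0 <= ((1 - t) * r - t * s) ^+ 2 by exact: sqr_ge0.
nra.
Qed.

Lemma vertex_coord V v i : cap_vertices V -> uncond_symmetric (cap_body V) ->
  V v -> v 0 i != 0 -> normsq v - v 0 i ^+ 2 <= 1.
Proof.
move=> hV hS hv vi.
have n0 : 0 <= normsq v - 1.
  by rewrite subr_ge0 leNgt; apply/negP => /ltW; exact: hV.2.1.
pose s : R := Num.sqrt (normsq v - 1).
have s0 : 0 <= s by exact: sqrtr_ge0.
have nv : normsq v = 1 + s ^+ 2 by rewrite sqr_sqrtr // addrC subrK.
have nr : normsq (reflect_coord i v) = 1 + s ^+ 2 by rewrite normsq_reflect.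
have ne : v <> reflect_coord i v.
  move/rowP/(_ i); rewrite mxE eqxx => /eqP; rewrite -subr_eq0 opprK.
  by rewrite -mulr2n mulrn_eq0 (negPf vi).
have := vertex_dot hV hv (vertex_reflect i hV hS hv) ne s0 s0 nv nr.
have -> : dot v (reflect_coord i v) = normsq v - 2 * v 0 i ^+ 2.
  rewrite /dot /normsq (bigD1 i) //= [in RHS](bigD1 i) //= !mxE eqxx.
  set X := \sum_(_ < _ | _) _; set Y := \sum_(_ < _ | _) _.
  have -> : X = Y by apply: eq_bigr => j ji; rewrite mxE (negPf ji).
  by ring.
clear ne; rewrite nv; nra.
Qed.

(** Flipping signs until [v] agrees with [x] in every coordinate keeps it a vertex and turns the
    inner product into a sum of absolute values. Later estimates can thus work with nonnegative
    coordinates. *)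
Lemma vertex_abs_dot V v x (r s : R) : cap_vertices V -> uncond_symmetric (cap_body V) ->
  V v -> V x -> 0 <= r -> 0 <= s -> normsq v = 1 + r ^+ 2 -> normsq x = 1 + s ^+ 2 ->
  (forall i, `|v 0 i| = `|x 0 i|) \/ \sum_(i < d) `|v 0 i| * `|x 0 i| <= 1 - r * s.
Proof.
move=> hV hS hv hx r0 s0 nv nx.
pose y : 'rV[R]_d := \row_i (if 0 <= x 0 i then `|v 0 i| else - `|v 0 i|).
have vy i : `|v 0 i| = `|y 0 i|.
  by rewrite mxE; case: ifP; rewrite ?normrN normr_id.
have hy := vertex_abs hV hS hv vy.
have [yx|/eqP yx] := eqVneq y x; first by left=> i; rewrite vy yx.
right; rewrite (normsq_abs vy) in nv.
have := vertex_dot hV hy hx yx r0 s0 nv nx.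
congr (_ <= _); apply: eq_bigr => i _; rewrite mxE.
case: ifP => [h|/negbT]; first by rewrite (ger0_norm h).
by rewrite -ltNge => /ltr0_norm ->; rewrite mulrN mulNr.
Qed.

End Symmetry.

(** * Axis directions and diagonal directions, and the points they aim at *)

Section Directions.
Variables (R : realType) (d : nat).
Implicit Types (x u : 'rV[R]_d) (i j k l : 'I_d).

Lemma dot_delta i x : dot (delta_mx 0 i) x = x 0 i.
Proof.
rewrite /dot (bigD1 i) //= mxE !eqxx mul1r big1 ?addr0 // => j ji.
by rewrite mxE (negPf ji) andbF mul0r.
Qed.

Definition axis_dirs i : seq 'rV[R]_d := [:: delta_mx 0 i; - delta_mx 0 i].

Lemma axis_dirs_unit i u : u \in axis_dirs i -> normsq u = 1.
Proof.
have h : normsq (delta_mx 0 i : 'rV[R]_d) = 1 by rewrite -dotxx dot_delta mxE !eqxx.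
by rewrite !inE => /orP[] /eqP ->; rewrite ?normsqN.
Qed.

Lemma axis_dirs_aims i x : 1 <= normsq x -> normsq x - 1 < x 0 i ^+ 2 ->
  exists2 u, u \in axis_dirs i & aims u x.
Proof.
move=> x1 xi; have [h|h] := lerP (x 0 i) 0.
  exists (delta_mx 0 i); first by rewrite inE eqxx.
  rewrite /aims dot_delta; split => //; rewrite lt_neqAle h andbT.
  by apply/eqP => e; move: xi; rewrite e; lra.
exists (- delta_mx 0 i); first by rewrite !inE eqxx orbT.
by rewrite /aims -scaleN1r dotZl dot_delta mulN1r sqrrN oppr_lt0.
Qed.

Definition diag_dirs i j : seq 'rV[R]_d :=
  let c := Num.sqrt 2^-1 in
  [seq a *: delta_mx 0 i + b *: delta_mx 0 j | a <- [:: c; - c], b <- [:: c; - c]].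

Lemma diag_dirs_unit i j u : i != j -> u \in diag_dirs i j -> normsq u = 1.
Proof.
move=> ij /allpairsP[[a b] /= [ha hb ->]].
have sq : Num.sqrt 2^-1 ^+ 2 = 2^-1 :> R by rewrite sqr_sqrtr // invr_ge0.
have ha2 : a ^+ 2 = 2^-1 by move: ha; rewrite !inE => /orP[] /eqP ->; rewrite ?sqrrN.
have hb2 : b ^+ 2 = 2^-1 by move: hb; rewrite !inE => /orP[] /eqP ->; rewrite ?sqrrN.
rewrite normsqD !normsqZ -!dotxx dotZl dotZr !dot_delta !mxE !eqxx (negPf ij) /= ha2 hb2.
by field.
Qed.

(** The best of the four sign choices opposes the signs of [x] and has inner product
    [- (|x_i| + |x_j|) / sqrt 2] with it. *)
Lemma diag_dirs_aims i j x : 1 <= normsq x ->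
  2 * (normsq x - 1) < (`|x 0 i| + `|x 0 j|) ^+ 2 ->
  exists2 u, u \in diag_dirs i j & aims u x.
Proof.
move=> x1 xij; set c : R := Num.sqrt 2^-1.
have c0 : 0 < c by rewrite sqrtr_gt0 invr_gt0.
have sq : c ^+ 2 = 2^-1 by rewrite sqr_sqrtr // invr_ge0.
pose g (t : R) := if 0 <= t then - c else c.
have gc t : g t \in [:: c; - c] by rewrite /g !inE; case: ifP; rewrite eqxx ?orbT.
have gt t : g t * t = - (c * `|t|).
  rewrite /g; case: ifP => [h|/negbT]; first by rewrite ger0_norm // mulNr.
  by rewrite -ltNge => /ltr0_norm ->; rewrite mulrN opprK.
exists (g (x 0 i) *: delta_mx 0 i + g (x 0 j) *: delta_mx 0 j).
  by apply/allpairsP; exists (g (x 0 i), g (x 0 j)); rewrite !gc.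
rewrite /aims dotDl !dotZl !dot_delta !gt.
have -> : - (c * `|x 0 i|) - c * `|x 0 j| = - (c * (`|x 0 i| + `|x 0 j|)) by ring.
rewrite sqrrN exprMn sq oppr_lt0; split; last by lra.
rewrite mulr_gt0 // lt_neqAle addr_ge0 // andbT; apply/eqP => e.
by move: xij; rewrite -e; lra.
Qed.

Lemma aims_cat (A B : seq 'rV[R]_d) x :
  (exists2 u, u \in A & aims u x) \/ (exists2 u, u \in B & aims u x) ->
  exists2 u, u \in A ++ B & aims u x.
Proof. by case=> -[u hu ux]; exists u; rewrite // mem_cat hu ?orbT. Qed.

Lemma cat_unit (A B : seq 'rV[R]_d) :
  (forall u, u \in A -> normsq u = 1) -> (forall u, u \in B -> normsq u = 1) ->
  forall u, u \in A ++ B -> normsq u = 1.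
Proof. by move=> hA hB u; rewrite mem_cat => /orP[/hA|/hB]. Qed.

End Directions.

(** * Two families of eight directions in dimension four *)

Section DimensionFour.
Variable R : realType.
Implicit Types (V : 'rV[R]_4 -> Prop) (v x u : 'rV[R]_4) (i j k l : 'I_4).

Lemma sum_ord4 (F : 'I_4 -> R) i j k l : uniq [:: i; j; k; l] ->
  \sum_m F m = F i + F j + F k + F l.
Proof.
move=> h; have hin m : m \in [:: i; j; k; l].
  have /(_ _)[] := @uniq_min_size _ [:: i; j; k; l] (enum 'I_4) h _ _.
  - by move=> z _; rewrite mem_enum.
  - by rewrite size_enum_ord.
  - by move=> _ ->; rewrite mem_enum.
transitivity (\sum_(m in [:: i; j; k; l]) F m).
  by apply: eq_bigl => m; rewrite hin.
by rewrite -big_uniq //= !big_cons big_nil addr0 !addrA.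
Qed.

Lemma complete_ord4 i j : i != j -> exists k l, uniq [:: i; j; k; l].
Proof.
move=> ij; have : #|~: [set i; j]| == 2.
  by rewrite -(eqn_add2l #|[set i; j]|) cardsC card_ord cards2 ij.
move=> /cards2P[k [l [kl /setP e]]]; exists k, l; rewrite /= !inE !negb_or ij kl.
have := e k; have := e l; rewrite !inE !eqxx orbT /=.
by rewrite !negb_or !(eq_sym i) !(eq_sym j) => /andP[-> ->] /andP[-> ->].
Qed.

Definition mixed_dirs i j k l : seq 'rV[R]_4 :=
  diag_dirs R i j ++ axis_dirs R k ++ axis_dirs R l.

(** The hypothesis is stated as a refutation: a point missed by all eight directions satisfies the
    three reverse inequalities at once, which is what the later polynomial arithmetic exploits. *)
Lemma mixed_dirs_aims i j k l x s : normsq x = 1 + s ^+ 2 ->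
  ((`|x 0 i| + `|x 0 j|) ^+ 2 <= 2 * s ^+ 2 -> `|x 0 k| ^+ 2 <= s ^+ 2 ->
    `|x 0 l| ^+ 2 <= s ^+ 2 -> False) ->
  exists2 u, u \in mixed_dirs i j k l & aims u x.
Proof.
move=> nx h.
have x1 : 1 <= normsq x by rewrite nx lerDl sqr_ge0.
have ns : normsq x - 1 = s ^+ 2 by rewrite nx addrC addKr.
have [h1|h1] := lerP ((`|x 0 i| + `|x 0 j|) ^+ 2) (2 * s ^+ 2); last first.
  by apply: aims_cat; left; apply: diag_dirs_aims; rewrite ?ns.
have [h2|] := lerP (`|x 0 k| ^+ 2) (s ^+ 2); last first.
  rewrite real_normK ?num_real // -ns => h2.
  by apply: aims_cat; right; apply: aims_cat; left; exact: axis_dirs_aims.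
have [h3|] := lerP (`|x 0 l| ^+ 2) (s ^+ 2); last first.
  rewrite real_normK ?num_real // -ns => h3.
  by apply: aims_cat; right; apply: aims_cat; right; exact: axis_dirs_aims.
by case: (h h1 h2 h3).
Qed.

Definition twin_dirs i j k l : seq 'rV[R]_4 := diag_dirs R i j ++ diag_dirs R k l.

Lemma twin_dirs_aims i j k l x s : normsq x = 1 + s ^+ 2 ->
  ((`|x 0 i| + `|x 0 j|) ^+ 2 <= 2 * s ^+ 2 ->
   (`|x 0 k| + `|x 0 l|) ^+ 2 <= 2 * s ^+ 2 -> False) ->
  exists2 u, u \in twin_dirs i j k l & aims u x.
Proof.
move=> nx h.
have x1 : 1 <= normsq x by rewrite nx lerDl sqr_ge0.
have ns : normsq x - 1 = s ^+ 2 by rewrite nx addrC addKr.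
have [h1|h1] := lerP ((`|x 0 i| + `|x 0 j|) ^+ 2) (2 * s ^+ 2); last first.
  by apply: aims_cat; left; apply: diag_dirs_aims; rewrite ?ns.
have [h2|h2] := lerP ((`|x 0 k| + `|x 0 l|) ^+ 2) (2 * s ^+ 2); last first.
  by apply: aims_cat; right; apply: diag_dirs_aims; rewrite ?ns.
by case: (h h1 h2).
Qed.

Definition fully_aimed V (U : seq 'rV[R]_4) :=
  [/\ (size U <= 8)%N, forall u, u \in U -> normsq u = 1 &
    forall x, V x \/ normsq x = 1 -> exists2 u, u \in U & aims u x].

Lemma mixed_dirs_full V i j k l : i != j ->
  (forall x s, V x \/ normsq x = 1 -> 0 <= s -> normsq x = 1 + s ^+ 2 ->
    (`|x 0 i| + `|x 0 j|) ^+ 2 <= 2 * s ^+ 2 -> `|x 0 k| ^+ 2 <= s ^+ 2 ->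
    `|x 0 l| ^+ 2 <= s ^+ 2 -> False) ->
  (forall x, V x -> ~ unit_ball x) ->
  fully_aimed V (mixed_dirs i j k l).
Proof.
move=> ij h Vout; split => // [|x hx].
  apply: cat_unit => [u|]; first exact: diag_dirs_unit.
  by apply: cat_unit => u; exact: axis_dirs_unit.
have x1 : 1 <= normsq x.
  by case: hx => [/Vout/negP|->//]; rewrite -ltNge => /ltW.
have sE : normsq x = 1 + Num.sqrt (normsq x - 1) ^+ 2.
  by rewrite sqr_sqrtr ?subr_ge0 // addrC subrK.
by apply: (mixed_dirs_aims sE); exact: (h _ _ hx (sqrtr_ge0 _) sE).
Qed.

Lemma twin_dirs_full V i j k l : i != j -> k != l ->
  (forall x s, V x \/ normsq x = 1 -> 0 <= s -> normsq x = 1 + s ^+ 2 ->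
    (`|x 0 i| + `|x 0 j|) ^+ 2 <= 2 * s ^+ 2 ->
    (`|x 0 k| + `|x 0 l|) ^+ 2 <= 2 * s ^+ 2 -> False) ->
  (forall x, V x -> ~ unit_ball x) ->
  fully_aimed V (twin_dirs i j k l).
Proof.
move=> ij kl h Vout; split => // [|x hx].
  by apply: cat_unit => u; exact: diag_dirs_unit.
have x1 : 1 <= normsq x.
  by case: hx => [/Vout/negP|->//]; rewrite -ltNge => /ltW.
have sE : normsq x = 1 + Num.sqrt (normsq x - 1) ^+ 2.
  by rewrite sqr_sqrtr ?subr_ge0 // addrC subrK.
by apply: (twin_dirs_aims sE); exact: (h _ _ hx (sqrtr_ge0 _) sE).
Qed.

End DimensionFour.

(** * Upper bound: case analysis on a tight vertex *)

Section UpperBound.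
Variable R : realType.
Implicit Types (V : 'rV[R]_4 -> Prop) (v x u : 'rV[R]_4) (i j k l : 'I_4).

Lemma normsq_ord4 i j k l x : uniq [:: i; j; k; l] ->
  normsq x = `|x 0 i| ^+ 2 + `|x 0 j| ^+ 2 + `|x 0 k| ^+ 2 + `|x 0 l| ^+ 2.
Proof. by move=> h; rewrite /normsq (sum_ord4 _ h) !real_normK ?num_real. Qed.

Definition all_axis_dirs : seq 'rV[R]_4 := flatten [seq axis_dirs R i | i <- enum 'I_4].

Lemma all_axis_dirs_full V : (forall x, V x -> ~ unit_ball x) ->
  (forall x, V x -> exists i, normsq x - 1 < x 0 i ^+ 2) ->
  fully_aimed V all_axis_dirs.
Proof.
move=> Vout h; split => [|u /flatten_mapP[i _] /axis_dirs_unit //|x hx].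
  by rewrite size_flatten /shape -map_comp sumnE big_map big_enum /= sum_nat_const card_ord.
have x1 : 1 <= normsq x.
  by case: hx => [/Vout/negP|->//]; rewrite -ltNge => /ltW.
have [i hi] : exists i, normsq x - 1 < x 0 i ^+ 2.
  case: hx => [/h//|e]; rewrite e subrr; apply: contrapT => n.
  suff x0 : normsq x = 0 by move: e; rewrite x0 => /eqP; rewrite eq_sym oner_eq0.
  rewrite /normsq big1 // => i _; apply/eqP; rewrite eq_le sqr_ge0 andbT leNgt.
  by apply/negP => hi; apply: n; exists i.
have [u uU hu] := axis_dirs_aims x1 hi.
by exists u => //; apply/flatten_mapP; exists i; rewrite ?mem_enum.
Qed.

(** For vertices of an unconditional cap body, [vertex_coord] gives one inequality at each nonzero
    coordinate, so these are exactly the vertices at which no axis direction aims. *)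
Definition tight v := forall i, v 0 i != 0 -> v 0 i ^+ 2 = normsq v - 1.

Lemma tight_support v : 1 < normsq v -> tight v ->
  exists i j k l (r : R), [/\ uniq [:: i; j; k; l], 0 < r, normsq v = 1 + r ^+ 2,
    `|v 0 i| = r /\ `|v 0 j| = r &
    (`|v 0 k| = r \/ `|v 0 k| = 0) /\ (`|v 0 l| = r \/ `|v 0 l| = 0)].
Proof.
move=> v1 hv; pose r := Num.sqrt (normsq v - 1).
have r0 : 0 < r by rewrite sqrtr_gt0 subr_gt0.
have nv : normsq v = 1 + r ^+ 2 by rewrite sqr_sqrtr ?ltW ?subr_gt0 // addrC subrK.
have vr m : `|v 0 m| = r \/ `|v 0 m| = 0.
  have [->|h] := eqVneq (v 0 m) 0; first by right; rewrite normr0.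
  by left; rewrite /r -(hv _ h) sqrtr_sqr.
have [i hi] : exists i, `|v 0 i| = r.
  apply: contrapT => n; suff v0 : normsq v = 0 by move: v1; rewrite v0 ltr10.
  rewrite /normsq big1 // => i _; case: (vr i) => [h|/eqP]; first by case: n; exists i.
  by rewrite normr_eq0 => /eqP ->; rewrite expr0n.
(* A single nonzero coordinate would give [r ^+ 2 = 1 + r ^+ 2]. *)
have [j ij hj] : exists2 j, i != j & `|v 0 j| = r.
  apply: contrapT => n; have := nv; rewrite /normsq (bigD1 i) //= big1 => [|j ji].
    by rewrite addr0 -real_normK ?num_real // hi; lra.
  case: (vr j) => [h|/eqP]; first by case: n; exists j; rewrite // eq_sym.
  by rewrite normr_eq0 => /eqP ->; rewrite expr0n.
have [k [l ijkl]] := complete_ord4 ij.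
by exists i, j, k, l, r; split.
Qed.

Lemma vertex_abs_dot4 V v x (r s : R) i j k l : cap_vertices V ->
  uncond_symmetric (cap_body V) -> uniq [:: i; j; k; l] ->
  V v -> V x -> 0 <= r -> 0 <= s -> normsq v = 1 + r ^+ 2 -> normsq x = 1 + s ^+ 2 ->
  (s = r /\ forall m, `|v 0 m| = `|x 0 m|) \/
  `|v 0 i| * `|x 0 i| + `|v 0 j| * `|x 0 j| + `|v 0 k| * `|x 0 k| + `|v 0 l| * `|x 0 l|
    <= 1 - r * s.
Proof.
move=> hV hS hu hv hx r0 s0 nv nx.
have [h|h] := vertex_abs_dot hV hS hv hx r0 s0 nv nx; last first.
  by right; rewrite -(sum_ord4 (fun m => `|v 0 m| * `|x 0 m|) hu).
left; split => //; apply/eqP; rewrite -(eqrXn2 (n := 2)) //; apply/eqP.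
by have := normsq_abs h; rewrite nv nx; lra.
Qed.

(** For a missed point the right-hand side is at most [4 * s ^+ 2], hence [1 <= 3 * s ^+ 2]. This
    disposes of unit vectors at once, where [s] vanishes. *)
Lemma pair_bound (a b c d s : R) : 0 <= a -> 0 <= b ->
  1 + s ^+ 2 = a ^+ 2 + b ^+ 2 + c ^+ 2 + d ^+ 2 ->
  1 + s ^+ 2 <= (a + b) ^+ 2 + c ^+ 2 + d ^+ 2.
Proof. by move=> a0 b0 ->; have := mulr_ge0 a0 b0; nra. Qed.

Lemma pairs_bound (a b c d s : R) : 0 <= a -> 0 <= b -> 0 <= c -> 0 <= d ->
  1 + s ^+ 2 = a ^+ 2 + b ^+ 2 + c ^+ 2 + d ^+ 2 ->
  1 + s ^+ 2 <= (a + b) ^+ 2 + (c + d) ^+ 2.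
Proof. by move=> a0 b0 c0 d0 ->; have := mulr_ge0 a0 b0; have := mulr_ge0 c0 d0; nra. Qed.

Lemma two_planes_full V v w i j k l : cap_vertices V -> uncond_symmetric (cap_body V) ->
  uniq [:: i; j; k; l] -> V v -> V w ->
  `|v 0 i| = 1 -> `|v 0 j| = 1 -> `|v 0 k| = 0 -> `|v 0 l| = 0 ->
  `|w 0 i| = 0 -> `|w 0 j| = 0 -> `|w 0 k| = 1 -> `|w 0 l| = 1 ->
  fully_aimed V (twin_dirs R i j k l).
Proof.
move=> hV hS hu hv hw vi vj vk vl wi wj wk wl.
have [ij kl] : i != j /\ k != l.
  by move: hu; rewrite /= !inE !negb_or => /and4P[/and3P[-> _ _] _ -> _].
have nv : normsq v = 1 + 1 ^+ 2 by rewrite (normsq_ord4 _ hu) vi vj vk vl; ring.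
have nw : normsq w = 1 + 1 ^+ 2 by rewrite (normsq_ord4 _ hu) wi wj wk wl; ring.
apply: twin_dirs_full => //; last exact: hV.2.1.
move=> x s hx s0 nx h1 h2.
have := nx; rewrite (normsq_ord4 _ hu) => /esym nx'.
have p2 := pairs_bound (normr_ge0 (x 0 i)) (normr_ge0 (x 0 j))
  (normr_ge0 (x 0 k)) (normr_ge0 (x 0 l)) nx'.
case: hx => [hx|x1]; last by rewrite x1 in nx; lra.
have [[sr e]|hb] := vertex_abs_dot4 hV hS hu hv hx ler01 s0 nv nx.
  by move: h1; rewrite -!e vi vj sr; lra.
have [[sr e]|hb'] := vertex_abs_dot4 hV hS hu hw hx ler01 s0 nw nx.
  by move: h2; rewrite -!e wk wl sr; lra.
rewrite vi vj vk vl in hb; rewrite wi wj wk wl in hb'.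
have := normr_ge0 (x 0 i); have := normr_ge0 (x 0 j).
have := normr_ge0 (x 0 k); have := normr_ge0 (x 0 l).
move: nx' h1 h2 hb hb' p2 => {nx nv nw vi vj vk vl wi wj wk wl hx hv hw hS hV hu}.
move: `|x 0 i| `|x 0 j| `|x 0 k| `|x 0 l| => a b c d.
move=> nx' h1 h2 hb hb' p2 d0 c0 b0 a0.
have q1 : a + b <= 1 - s by lra.
have q2 : c + d <= 1 - s by lra.
have q3 : (a + b) ^+ 2 <= (1 - s) ^+ 2 by nra.
have q4 : (c + d) ^+ 2 <= (1 - s) ^+ 2 by nra.
(* The bounds give [1 + s ^+ 2 <= 2 * (1 - s) ^+ 2], hence [s <= 2 - sqrt 3], against
   [1 <= 3 * s ^+ 2]. *)
nra.
Qed.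

(** The only vertices these directions could miss are those with absolute values (0,0,1,1), which
    the last hypothesis excludes. *)
Lemma one_plane_full V v i j k l : cap_vertices V -> uncond_symmetric (cap_body V) ->
  uniq [:: i; j; k; l] -> V v ->
  `|v 0 i| = 1 -> `|v 0 j| = 1 -> `|v 0 k| = 0 -> `|v 0 l| = 0 ->
  ~ (exists w, [/\ V w, `|w 0 i| = 0 /\ `|w 0 j| = 0 & `|w 0 k| = 1 /\ `|w 0 l| = 1]) ->
  fully_aimed V (mixed_dirs R i j k l).
Proof.
move=> hV hS hu hv vi vj vk vl hno.
have ij : i != j by move: hu; rewrite /= !inE !negb_or => /and4P[/and3P[]].
have nv : normsq v = 1 + 1 ^+ 2 by rewrite (normsq_ord4 _ hu) vi vj vk vl; ring.
apply: mixed_dirs_full => //; last exact: hV.2.1.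
move=> x s hx s0 nx h1 h2 h3.
have := nx; rewrite (normsq_ord4 _ hu) => /esym nx'.
have p1 := pair_bound (normr_ge0 (x 0 i)) (normr_ge0 (x 0 j)) nx'.
case: hx => [hx|x1]; last by rewrite x1 in nx; lra.
have [[sr e]|hb] := vertex_abs_dot4 hV hS hu hv hx ler01 s0 nv nx.
  by move: h1; rewrite -!e vi vj sr; lra.
rewrite vi vj vk vl in hb.
apply: hno; exists x.
have := normr_ge0 (x 0 i); have := normr_ge0 (x 0 j).
have := normr_ge0 (x 0 k); have := normr_ge0 (x 0 l).
move: nx' h1 h2 h3 hb p1 => {nx nv vi vj vk vl hv hS hV}.
move: `|x 0 i| `|x 0 j| `|x 0 k| `|x 0 l| => a b c d.
move=> nx' h1 h2 h3 hb p1 d0 c0 b0 a0.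
have q1 : a + b <= 1 - s by lra.
have q3 : (a + b) ^+ 2 <= (1 - s) ^+ 2 by nra.
(* [1 + s ^+ 2 <= (1 - s) ^+ 2 + 2 * s ^+ 2] means [s <= s ^+ 2], and [s] is not 0. With
   [a + b <= 1 - s] everything is then determined. *)
have s1 : 1 <= s by nra.
have ea : a = 0 by lra.
have eb : b = 0 by lra.
have es : s = 1 by lra.
rewrite ea eb es in nx' h2 h3.
have ec : c ^+ 2 = 1 by lra.
have ed : d ^+ 2 = 1 by lra.
split => //; split; apply/eqP; rewrite -(eqrXn2 (n := 2)) // ?expr1n; exact/eqP.
Qed.

Lemma cube_full V v (r : R) i j k l : cap_vertices V -> uncond_symmetric (cap_body V) ->
  uniq [:: i; j; k; l] -> V v -> 0 < r -> normsq v = 1 + r ^+ 2 ->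
  `|v 0 i| = r -> `|v 0 j| = r -> `|v 0 k| = r -> `|v 0 l| = 0 ->
  fully_aimed V (mixed_dirs R i j k l).
Proof.
move=> hV hS hu hv r0 nv vi vj vk vl.
have ij : i != j by move: hu; rewrite /= !inE !negb_or => /and4P[/and3P[]].
have r2 : r ^+ 2 = 2^-1.
  by move: nv; rewrite (normsq_ord4 _ hu) vi vj vk vl; lra.
apply: mixed_dirs_full => //; last exact: hV.2.1.
move=> x s hx s0 nx h1 h2 h3.
have := nx; rewrite (normsq_ord4 _ hu) => /esym nx'.
have p1 := pair_bound (normr_ge0 (x 0 i)) (normr_ge0 (x 0 j)) nx'.
case: hx => [hx|x1]; last by rewrite x1 in nx; lra.
have [[sr e]|hb] := vertex_abs_dot4 hV hS hu hv hx (ltW r0) s0 nv nx.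
  by move: h1; rewrite -!e vi vj sr; nra.
rewrite vi vj vk vl in hb.
have := normr_ge0 (x 0 i); have := normr_ge0 (x 0 j).
have := normr_ge0 (x 0 k); have := normr_ge0 (x 0 l).
move: nx' h1 h2 h3 hb p1 => {nx nv vi vj vk vl hv hx hS hV hu}.
move: `|x 0 i| `|x 0 j| `|x 0 k| `|x 0 l| => a b c d.
move=> nx' h1 h2 h3 hb p1 d0 c0 b0 a0.
(* [r ^+ 2 = 2^-1] turns the bound [1 - r * s] into [r * (2 * r - s)]. *)
have q1 : a + b + c + s <= 2 * r.
  rewrite -(ler_pM2l r0); move: hb; lra.
have q2 : 1 <= (a + b + c) ^+ 2 by nra.
have q3 : 1 <= a + b + c by nra.
(* Rounding [2 * r = sqrt 2] up to 3/2 suffices: then [s <= 1 / 2], against [1 <= 3 * s ^+ 2]. *)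
have q4 : 2 * r <= 3 / 2 by nra.
nra.
Qed.

Lemma tesseract_full V v (r : R) i j k l : cap_vertices V -> uncond_symmetric (cap_body V) ->
  uniq [:: i; j; k; l] -> V v -> 0 < r -> normsq v = 1 + r ^+ 2 ->
  `|v 0 i| = r -> `|v 0 j| = r -> `|v 0 k| = r -> `|v 0 l| = r ->
  fully_aimed V (twin_dirs R i j k l).
Proof.
move=> hV hS hu hv r0 nv vi vj vk vl.
have [ij kl] : i != j /\ k != l.
  by move: hu; rewrite /= !inE !negb_or => /and4P[/and3P[-> _ _] _ -> _].
have r2 : r ^+ 2 = 3^-1.
  by move: nv; rewrite (normsq_ord4 _ hu) vi vj vk vl; lra.
apply: twin_dirs_full => //; last exact: hV.2.1.
move=> x s hx s0 nx h1 h2.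
have := nx; rewrite (normsq_ord4 _ hu) => /esym nx'.
have p2 := pairs_bound (normr_ge0 (x 0 i)) (normr_ge0 (x 0 j))
  (normr_ge0 (x 0 k)) (normr_ge0 (x 0 l)) nx'.
case: hx => [hx|x1]; last by rewrite x1 in nx; lra.
have [[sr e]|hb] := vertex_abs_dot4 hV hS hu hv hx (ltW r0) s0 nv nx.
  by move: h1; rewrite -!e vi vj sr; nra.
rewrite vi vj vk vl in hb.
have := normr_ge0 (x 0 i); have := normr_ge0 (x 0 j).
have := normr_ge0 (x 0 k); have := normr_ge0 (x 0 l).
move: nx' h1 h2 hb p2 => {nx nv vi vj vk vl hv hx hS hV hu}.
move: `|x 0 i| `|x 0 j| `|x 0 k| `|x 0 l| => a b c d.
move=> nx' h1 h2 hb p2 d0 c0 b0 a0.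
have q1 : a + b + (c + d) + s <= 3 * r.
  rewrite -(ler_pM2l r0); move: hb; lra.
have A0 : 0 <= a + b by lra.
have C0 : 0 <= c + d by lra.
clear nx' hb d0 c0 b0 a0; move: (a + b) (c + d) A0 C0 h1 h2 p2 q1 => A C A0 C0 h1 h2 p2 q1.
have s1 : r <= s by nra.
have q2 : (A + C) ^+ 2 <= (3 * r - s) ^+ 2 by nra.
have AC := mulr_ge0 A0 C0.
(* [1 + s ^+ 2 <= (A + C) ^+ 2 <= (3 * r - s) ^+ 2] and [r ^+ 2 = 3^-1] give [r * s <= r ^+ 2]. *)
have s2 : s <= r by nra.
have es : s = r by lra.
rewrite es in h1 h2 p2 q1 q2.
(* Now [A ^+ 2] and [C ^+ 2] must both equal 2/3, whereas [(A + C) ^+ 2 <= 4 / 3] forces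
   [A * C = 0]. *)
nra.
Qed.

Lemma exists_fully_aimed V : cap_vertices V -> uncond_symmetric (cap_body V) ->
  exists U, fully_aimed V U.
Proof.
move=> hV hS.
have Vgt x : V x -> 1 < normsq x by move=> /hV.2.1/negP; rewrite -ltNge.
have [[v [hv tv]]|hno] := pselect (exists v, V v /\ tight v); last first.
  exists all_axis_dirs; apply: all_axis_dirs_full; first exact: hV.2.1.
  move=> x hx; apply: contrapT => n; apply: hno; exists x; split => // i xi.
  apply/eqP; rewrite eq_le; apply/andP; split.
    by rewrite leNgt; apply/negP => h; apply: n; exists i.
  by have := vertex_coord hV hS hx xi; lra.
have [i [j [k [l [r [hu r0 nv [vi vj] [vk vl]]]]]]] := tight_support (Vgt _ hv) tv.
case: vk vl => vk [] vl.
- by exists (twin_dirs R i j k l); exact: tesseract_full nv vi vj vk vl.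
- by exists (mixed_dirs R i j k l); exact: cube_full nv vi vj vk vl.
- exists (mixed_dirs R i j l k); apply: cube_full nv vi vj vl vk => //.
  by rewrite -(perm_uniq (s1 := [:: i; j; k; l])) //; apply/permP => P /=; ring.
- have r1 : r = 1.
    apply/eqP; rewrite -(eqrXn2 (n := 2)) ?ltW //; apply/eqP.
    by move: nv; rewrite (normsq_ord4 _ hu) vi vj vk vl; lra.
  rewrite r1 in vi vj.
  (* The mixed directions would miss a tight vertex in the complementary coordinate plane, so its
     presence decides between the two families. *)
  have [[w [hw [wi wj] [wk wl]]]|h] := pselect
    (exists w, [/\ V w, `|w 0 i| = 0 /\ `|w 0 j| = 0 & `|w 0 k| = 1 /\ `|w 0 l| = 1]).
    by exists (twin_dirs R i j k l); exact: (two_planes_full hV hS hu hv hw).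
  by exists (mixed_dirs R i j k l); exact: (one_plane_full hV hS hu hv).
Qed.

Lemma illuminable_mono V m n : (m <= n)%N ->
  illuminable (cap_body V) m -> illuminable (cap_body V) n.
Proof. by move=> mn [U [hU h]]; exists U; split => //; exact: leq_trans mn. Qed.

Lemma illumination_le8 V : cap_vertices V -> uncond_symmetric (cap_body V) ->
  exists n : nat, is_illumination_number (cap_body V) n /\ (n <= 8)%N.
Proof.
move=> hV hS; have [U [sU U1 hU]] := exists_fully_aimed hV hS.
have h8 : illuminable (cap_body V) 8.
  exact: illuminable_mono sU (illuminable_aims hV U1 hU).
have ex : exists n, `[< illuminable (cap_body V) n >] by exists 8%N; apply/asboolP.
have [n /asboolP hn hmin] := ex_minnP ex.
exists n; split; last by apply: hmin; apply/asboolP.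
by split => // m hm; apply: hmin; apply/asboolP.
Qed.

End UpperBound.

(** * Sharpness: the cap body with vertices [+-sqrt 2 e_i], in any dimension *)

Section CrossPolytope.
Variables (R : realType) (d : nat).
Implicit Types (x y z n u : 'rV[R]_d) (V : 'rV[R]_d -> Prop) (k : 'I_d * bool).

Lemma dot_sumr n (s : seq (R * 'rV[R]_d)) :
  dot n (\sum_(p <- s) p.1 *: p.2) = \sum_(p <- s) p.1 * dot n p.2.
Proof.
elim: s => [|p s IH]; last by rewrite !big_cons dotDr dotZr IH.
by rewrite !big_nil /dot big1 // => i _; rewrite mxE mulr0.
Qed.

Lemma cap_body_dot_le V n (M : R) x :
  (forall y, unit_ball y \/ V y -> dot n y <= M) -> cap_body V x -> dot n x <= M.
Proof.
move=> h [s [hs [s1 ->]]]; rewrite dot_sumr -[leRHS]mul1r -s1 mulr_suml.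
rewrite !big_seq; apply: ler_sum => p /hs[hp p0].
by apply: ler_wpM2l => //; exact: h.
Qed.

(** An interior point can still be pushed a little along [n], which strictly raises the
    functional. *)
Lemma interior_dot_lt V n (M : R) z : 0 < normsq n ->
  (forall y, unit_ball y \/ V y -> dot n y <= M) -> interior (cap_body V) z -> dot n z < M.
Proof.
move=> n0 h [e [e0 he]]; pose t := Num.min 1 (e / (2 * normsq n)).
have t0 : 0 < t by rewrite lt_min ltr01 divr_gt0 // mulr_gt0.
have t1 : t <= 1 by rewrite ge_min lexx.
have te : t * (2 * normsq n) <= e by rewrite -ler_pdivlMr ?mulr_gt0 // ge_min lexx orbT.
have hz : normsq (z + t *: n - z) < e.
  by rewrite addrAC subrr add0r normsqZ; nra.
have := cap_body_dot_le h (he _ hz); rewrite dotDr dotZr dotxx => hM.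
by have := mulr_gt0 t0 n0; lra.
Qed.

(** Cauchy-Schwarz without roots: summing [(n_i - M y_i)^2 >= 0] over the coordinates. *)
Lemma ball_dot_le n (M : R) y : 0 < M -> normsq n <= M ^+ 2 -> unit_ball y -> dot n y <= M.
Proof.
rewrite /unit_ball => M0 hn hy.
have h : 2 * M * dot n y <= normsq n + M ^+ 2 * normsq y.
  rewrite /dot /normsq !mulr_sumr -big_split; apply: ler_sum => i _ /=.
  by have := sqr_ge0 (n 0 i - M * y 0 i); nra.
by rewrite -(ler_pM2l (mulr_gt0 (ltr0n R 2) M0)); nra.
Qed.

Definition spike k : 'rV[R]_d := ((-1) ^+ k.2 * Num.sqrt 2) *: delta_mx 0 k.1.

Definition spikes x := exists k, x = spike k.

Lemma sqrt2_gt0 : 0 < Num.sqrt 2 :> R.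
Proof. by rewrite sqrtr_gt0. Qed.

Lemma sqr_sqrt2 : Num.sqrt 2 ^+ 2 = 2 :> R.
Proof. by rewrite sqr_sqrtr. Qed.

Lemma dot_spike k x : dot x (spike k) = (-1) ^+ k.2 * Num.sqrt 2 * x 0 k.1.
Proof. by rewrite dotZr dotC dot_delta. Qed.

Lemma spikeE k i : spike k 0 i = if i == k.1 then (-1) ^+ k.2 * Num.sqrt 2 else 0.
Proof. by rewrite !mxE eqxx /=; case: eqP; rewrite ?mulr1 ?mulr0. Qed.

Lemma normsq_spike k : normsq (spike k) = 2.
Proof.
rewrite -dotxx dot_spike spikeE eqxx -expr2 exprMn sqr_sqrt2.
by rewrite -exprM mulnC exprM sqrrN !expr1n mul1r.
Qed.

Lemma spikes_cap_vertices : cap_vertices spikes.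
Proof.
split; last split.
- exists (fun m => if unpickle m is Some k then spike k else 0) => v [k ->].
  by exists (pickle k); rewrite pickleK.
- by move=> v [k ->]; rewrite /unit_ball normsq_spike => h; lra.
(* The midpoint has squared norm [(4 + 2 * dot v w) / 4], so it suffices that the inner product is
   at most 0. *)
move=> v w [k ->] [k' ->] kk'; exists 2^-1; split.
  by apply/andP; split; lra.
have h : dot (spike k) (spike k') <= 0.
  rewrite dot_spike spikeE; case: eqP => [e|_]; last by rewrite mulr0.
  have : k.2 != k'.2.
    apply/eqP => e2; apply: kk'; congr spike.
    by move: e e2; case: (k) (k') => [? ?] [? ?] /= -> ->.
  have := sqr_sqrt2; case: k.2 k'.2 => -[] //= h _; rewrite ?expr0 ?expr1; nra.
move: h (normsq_spike k) (normsq_spike k').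
move: (spike k) (spike k') => x y h nx ny.
rewrite /unit_ball normsqD !normsqZ dotZl dotZr nx ny; nra.
Qed.

Lemma cap_body_reflect V i x : (forall v, V v -> V (reflect_coord i v)) ->
  cap_body V x -> cap_body V (reflect_coord i x).
Proof.
move=> hV [s [hs [s1 ->]]].
exists [seq (p.1, reflect_coord i p.2) | p <- s]; split; last split.
- move=> q /mapP[p /hs[hp p0] ->] /=; split => //.
  by case: hp => hp; [left; rewrite /unit_ball normsq_reflect|right; exact: hV].
- by rewrite big_map.
- rewrite big_map /=; elim: s {hs s1} => [|p s IH].
    by rewrite !big_nil; apply/rowP => j; rewrite !mxE oppr0 if_same.
  rewrite !big_cons -IH; have := reflect_coord_lin i p.1 1 p.2 (\sum_(q <- s) q.1 *: q.2).
  by rewrite !scale1r.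
Qed.

Lemma spikes_symmetric : uncond_symmetric (cap_body spikes).
Proof.
have hV i v : spikes v -> spikes (reflect_coord i v).
  move=> [k ->]; exists (k.1, k.2 (+) (k.1 == i)); apply/rowP => j.
  rewrite mxE !spikeE /=; case: (eqVneq j k.1) => [->|_]; last by rewrite oppr0 if_same.
  by case: eqP; rewrite ?addbF // addbT signrN mulNr.
move=> i x; split; first exact: (cap_body_reflect (hV i)).
by move=> /(cap_body_reflect (hV i)); rewrite reflect_coordK.
Qed.

(** The value [sqrt 2 * a] bounds the functional on the ball through its norm and on the spikes
    through its largest coordinate. *)
Lemma spikes_interior n (a : R) z : 0 < a -> normsq n <= 2 * a ^+ 2 ->
  (forall i, `|n 0 i| <= a) -> 0 < normsq n ->
  interior (cap_body spikes) z -> dot n z < Num.sqrt 2 * a.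
Proof.
move=> a0 na ni n0; apply: interior_dot_lt => // y [|[k ->]].
  apply: ball_dot_le; first by rewrite mulr_gt0 // sqrt2_gt0.
  by rewrite exprMn sqr_sqrt2.
rewrite dot_spike mulrAC mulrC ler_pM2l ?sqrt2_gt0 //.
by apply: le_trans (ler_norm _) _; rewrite normrMsign.
Qed.

Lemma sign_delta_props k (n := (-1) ^+ k.2 *: delta_mx 0 k.1 : 'rV[R]_d) :
  normsq n = 1 /\ forall i, `|n 0 i| <= 1.
Proof.
split.
  by rewrite normsqZ -exprM mulnC exprM sqrrN !expr1n mul1r -dotxx dot_delta mxE !eqxx.
move=> i; rewrite !mxE eqxx /= normrMsign.
by case: eqP; rewrite ?normr1 // normr0 ler01.
Qed.

Lemma spike_boundary k : boundary (cap_body spikes) (spike k).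
Proof.
split.
  move=> e e0; exists (spike k); split; first by apply: vertex_cap_body; exists k.
  by rewrite subrr -(scale0r (spike k)) normsqZ expr0n mul0r.
have [n1 ni] := sign_delta_props k.
move=> /(spikes_interior ltr01 _ ni); rewrite n1 expr1n mulr1 => /(_ _ ltr01).
rewrite dot_spike !mxE !eqxx /= mulr1 mulrAC -expr2 -exprM mulnC exprM sqrrN !expr1n mul1r.
by rewrite mulr1 ltxx => /(_ ltac:(lra)).
Qed.

(* The support functional below is normal to the cone with apex at the spike
   that touches the ball, along the generator closest to the direction [u]. *)
Lemma spike_illuminated k u : normsq u = 1 -> illuminates (cap_body spikes) u (spike k) ->
  (-1) ^+ k.2 * u 0 k.1 < 0 /\ 1 / 2 < u 0 k.1 ^+ 2.
Proof.
move=> u1 [lam [lam0 hint]].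
set sg : R := (-1) ^+ k.2; have sg2 : sg * sg = 1.
  by rewrite -expr2 -exprM mulnC exprM sqrrN !expr1n.
(* Such an [n] attains its maximum [sqrt 2 * a] at the spike, so every direction leading into the
   interior decreases it. *)
have neg n (a : R) : 0 < a -> normsq n <= 2 * a ^+ 2 -> (forall i, `|n 0 i| <= a) ->
    n 0 k.1 = a * sg -> dot n u < 0.
  move=> a0 na ni nk; have n0 : 0 < normsq n.
    rewrite /normsq (bigD1 k.1) //= nk exprMn [sg ^+ 2]expr2 sg2 mulr1.
    by rewrite ltr_wpDr ?exprn_gt0 //; apply: sumr_ge0 => i _; exact: sqr_ge0.
  have := spikes_interior a0 na ni n0 hint.
  rewrite dotDr dotZr dot_spike nk -/sg.
  have -> : sg * Num.sqrt 2 * (a * sg) = sg * sg * (Num.sqrt 2 * a) by ring.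
  by rewrite sg2 mul1r gtrDl pmulr_rlt0.
have [n1 ni] := sign_delta_props k.
have h1 : sg * u 0 k.1 < 0.
  rewrite -dot_delta -dotZl; apply: (neg _ 1) => //.
    by rewrite n1 expr1n mulr1 ler1n.
  by rewrite !mxE !eqxx mulr1 mul1r.
split => //; have [h0|h0] := lerP (1 - u 0 k.1 ^+ 2) 0; first lra.
pose a := Num.sqrt (1 - u 0 k.1 ^+ 2).
have a0 : 0 < a by rewrite sqrtr_gt0.
have a2 : a ^+ 2 = 1 - u 0 k.1 ^+ 2 by rewrite sqr_sqrtr // ltW.
pose n : 'rV[R]_d := \row_i (if i == k.1 then a * sg else u 0 i).
have uS : normsq u = u 0 k.1 ^+ 2 + \sum_(i | i != k.1) u 0 i ^+ 2.
  by rewrite /normsq (bigD1 k.1).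
have h2 : dot n u < 0.
  apply: (neg _ a) => //; last by rewrite mxE eqxx.
    rewrite /normsq (bigD1 k.1) //= mxE eqxx exprMn [sg ^+ 2]expr2 sg2 mulr1.
    under eq_bigr => i ik do rewrite mxE (negPf ik).
    by lra.
  move=> i; rewrite mxE; case: eqP => [_|/eqP ik].
    by rewrite mulrC normrMsign ger0_norm // ltW.
  rewrite -[leRHS]ger0_norm ?(ltW a0) // -ler_sqr ?nnegrE ?normr_ge0 //.
  rewrite !real_normK ?num_real // a2.
  move: uS; rewrite (bigD1 i) //= u1 => uS.
  have : 0 <= \sum_(j | (j != k.1) && (j != i)) u 0 j ^+ 2.
    by apply: sumr_ge0 => j _; exact: sqr_ge0.
  by lra.
have : dot n u = a * sg * u 0 k.1 + a ^+ 2.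
  rewrite /dot (bigD1 k.1) //= mxE eqxx; congr (_ + _).
  under eq_bigr => i ik do rewrite mxE (negPf ik) -expr2.
  by lra.
move=> e; rewrite e in h2.
(* Hence [a < - sg * u 0 k.1]; squaring compares [1 - u 0 k.1 ^+ 2] with [u 0 k.1 ^+ 2]. *)
have h3 : a + sg * u 0 k.1 < 0 by rewrite -(pmulr_rlt0 _ a0); lra.
have h4 : u 0 k.1 ^+ 2 = (sg * u 0 k.1) ^+ 2 by rewrite exprMn [sg ^+ 2]expr2 sg2 mul1r.
by nra.
Qed.

Lemma spikes_lower m : illuminable (cap_body spikes) m -> (d * 2 <= m)%N.
Proof.
move=> [U [sU [U1 hU]]]; apply: leq_trans sU.
pose P k (u : 'rV[R]_d) := ((-1) ^+ k.2 * u 0 k.1 < 0) && (1 / 2 < u 0 k.1 ^+ 2).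
have hP k : has (P k) U.
  have [u uU hu] := hU _ (spike_boundary k).
  by apply/hasP; exists u => //; apply/andP; apply: spike_illuminated => //; exact: U1.
pose g k := nth 0 U (find (P k) U).
have gP k : P k (g k) by exact: nth_find.
have gU k : g k \in U by rewrite mem_nth // -has_find.
have g_inj : injective g.
  move=> [i b] [j c] e; have /andP[/= h1 h2] := gP (i, b).
  have /andP[/= h3 h4] := gP (j, c).
  have := U1 _ (gU (i, b)); move: h3 h4; rewrite -e => h3 h4.
  (* Opposite spikes demand opposite signs of one coordinate; spikes on different axes demand two
     squares above 1/2 in a unit vector. *)
  have [ij|ij] := eqVneq i j.
    move: h3 h4; rewrite -ij => h3 h4 _; congr (_, _).
    by move: h1 h3; clear e; case: (b) (c) => -[]; rewrite ?expr0 ?expr1 // => *; exfalso; lra.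
  rewrite /normsq (bigD1 i) //= (bigD1 j) ?(eq_sym j) //= => h.
  have : 0 <= \sum_(m0 < d | (m0 != i) && (m0 != j)) g (i, b) 0 m0 ^+ 2.
    by apply: sumr_ge0 => *; exact: sqr_ge0.
  clear e; move=> S0; exfalso; lra.
have gu : uniq [seq g k | k <- enum {: 'I_d * bool}] by rewrite map_inj_uniq ?enum_uniq.
have := uniq_leq_size gu; rewrite size_map -cardT card_prod card_ord card_bool.
by apply=> u /mapP[k _ ->].
Qed.

End CrossPolytope.

Theorem theorem3 (R : realType) :
  (forall V : 'rV[R]_4 -> Prop,
     cap_vertices V -> uncond_symmetric (cap_body V) ->
     exists n : nat, is_illumination_number (cap_body V) n /\ (n <= 8)%N) /\
  (exists V : 'rV[R]_4 -> Prop,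
     cap_vertices V /\ uncond_symmetric (cap_body V) /\
     is_illumination_number (cap_body V) 8).
Proof.
split; first exact: illumination_le8.
have hV := @spikes_cap_vertices R 4; have hS := @spikes_symmetric R 4.
exists (@spikes R 4); do 2 split => //.
have [n [[hn hmin] n8]] := illumination_le8 hV hS.
have -> : 8%N = n by apply/eqP; rewrite eqn_leq n8 (spikes_lower hn).
by split.
Qed.
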